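(* Fix a 3D rotation system, i.e. an orthonormal coordinate system of $\mathbb{R}^3$ together with an image plane $P$ through the origin (spanned by two of the coordinate axes) and the remaining coordinate axis, perpendicular to the image. Suppose an image contains a human head whose intrinsic rotation in this system is $R\in SO(3)$. For an angle $\phi\in\mathbb{R}$, let $R_{\mathrm{rotate\_img}}(\phi)\in SO(3)$ be the 3D head rotation associated with rotating this image by the angle $\phi$ counter-clockwise, and let $R_{\mathrm{extr}}(\phi)$ be the extrinsic rotation by the angle $\phi$ about the axis perpendicular to the image. Then $R_{\mathrm{rotate\_img}}(\phi)$ is obtained by applying the extrinsic rotation $R_{\mathrm{extr}}(\phi)$ to $R$, that is, $$R_{\mathrm{rotate\_img}}(\phi)=R_{\mathrm{extr}}(\phi)\, R .$$
   Context: A rotation matrix is $R\in SO(3)$, acting on column vectors from the left; its $j$-th column is the position, in the fixed (extrinsic) coordinates, of the $j$-th axis of the coordinate system attached to the head (intrinsic system), which coincides with the extrinsic one when $R=I_3$. The image shows the orthogonal projection onto the image plane $P$ (along the perpendicular axis) of the three rotated head axes, i.e. of the columns of $R$. The plane $P$ is oriented as seen by the viewer of the image, so that ''counter-clockwise'' is meaningful in $P$; let $\rho_\phi:P\to P$ be the counter-clockwise rotation of $P$ by $\phi$ about the origin. $R_{\mathrm{extr}}(\phi)$ is the linear map of $\mathbb{R}^3$ (written as a matrix in the extrinsic coordinates) that acts as $\rho_\phi$ on $P$ and fixes the axis perpendicular to $P$ pointwise. The head rotation associated with the image rotated by $\phi$ is the matrix $R'\in SO(3)$ whose projected head axes are those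 displayed in the rotated image: for each $j\in\{1,2,3\}$, the orthogonal projection onto $P$ of the $j$-th column of $R'$ equals $\rho_\phi$ applied to the orthogonal projection onto $P$ of the $j$-th column of $R$. *)

(* Defs.v *)
From HB Require Import structures.
From mathcomp Require Import all_boot all_order all_algebra.
From mathcomp Require Import reals trigo ring.

Set Implicit Arguments.
Unset Strict Implicit.
Unset Printing Implicit Defensive.

Import Order.TTheory GRing.Theory Num.Theory.

Local Open Scope ring_scope.

(* The coordinate axes are numbered by 'I_3.  The image plane is spanned by    *)
(* the axes ax1 and ax2, and axp is perpendicular to it.  The order of ax1 and *)
(* ax2 records the orientation of the plane as seen by the viewer: the         *)
(* counter-clockwise quarter turn maps ax1 to ax2.  The six choices are the    *)
(* three coordinate planes with their two orientations (the perpendicular axis *)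
(* pointing to the viewer or away from the viewer, in a left- or right-handed  *)
(* system).                                                                    *)
Record rotation_system := RotationSystem {
  ax1 : 'I_3;
  ax2 : 'I_3;
  axp : 'I_3;
  axes_uniq : uniq [:: ax1; ax2; axp]
}.

Definition is_SO3 (R : realType) (A : 'M[R]_3) : Prop :=
  A^T *m A = 1%:M /\ \det A = 1.

Section RotationSystem.
Variables (R : realType) (S : rotation_system).
Implicit Types (v : 'cV[R]_3) (A : 'M[R]_3) (phi : R).

Definition axis (i : 'I_3) : 'cV[R]_3 := delta_mx i 0.

Definition proj v : 'cV[R]_3 := v - v (axp S) 0 *: axis (axp S).

(* Meaningful for v in the image plane, i.e. when v (axp S) 0 = 0.             *)
Definition plane_rot phi v : 'cV[R]_3 :=
  (cos phi * v (ax1 S) 0 - sin phi * v (ax2 S) 0) *: axis (ax1 S)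
  + (sin phi * v (ax1 S) 0 + cos phi * v (ax2 S) 0) *: axis (ax2 S).

(* Written column by column: the j-th column is the image of the j-th basis    *)
(* vector under the linear map v |-> plane_rot phi (proj v) + (v - proj v).    *)
Definition extr_rot phi : 'M[R]_3 :=
  \matrix_(i, j) (plane_rot phi (proj (axis j)) + (axis j - proj (axis j))) i 0.

Lemma extr_rotE phi v :
  extr_rot phi *m v = plane_rot phi (proj v) + (v - proj v).
Proof.
apply/colP => i; rewrite mxE.
under eq_bigr do rewrite mxE.
rewrite /plane_rot /proj /axis.
have sum_delta (k : 'I_3) : v k 0 = \sum_j (k == j)%:R * v j 0.
  rewrite (bigD1 k) //= eqxx mul1r big1 ?addr0 // => j /negPf.
  by rewrite eq_sym => ->; rewrite mul0r.
rewrite !mxE !eqxx !andbT (sum_delta (ax1 S)) (sum_delta (ax2 S)).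
rewrite (sum_delta (axp S)) (sum_delta i) !big_ord_recl !big_ord0.
by rewrite !mxE !eqxx !andbT; ring.
Qed.

Lemma extr_rot_plane phi v :
  v (axp S) 0 = 0 -> extr_rot phi *m v = plane_rot phi v.
Proof. by move=> v0; rewrite extr_rotE /proj v0 scale0r subr0 subrr addr0. Qed.

Lemma extr_rot_axis phi : extr_rot phi *m axis (axp S) = axis (axp S).
Proof.
rewrite extr_rotE /proj mxE !eqxx scale1r subrr subr0 /plane_rot !mxE.
by rewrite !mulr0 subrr addr0 !scale0r !add0r.
Qed.

Definition is_rotate_img A phi (A' : 'M[R]_3) : Prop :=
  is_SO3 A' /\
  forall j : 'I_3, proj (col j A') = plane_rot phi (proj (col j A)).

End RotationSystem.

(* Main.v *)
(* A head rotation and its candidate [extr_rot S phi *m A] have the same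
   projected axes iff their rows agree except possibly for the row of the
   perpendicular axis.  A rotation is its own cofactor matrix, so that this row
   is determined by the other two.  That the extrinsic rotations are in SO(3)
   follows from their forming a one-parameter group: the transpose is the
   rotation by the opposite angle, and the determinant is the square of the
   determinant for half the angle, hence 1 by orthogonality. *)
Require Import Defs.
From mathcomp Require Import all_boot all_order all_algebra.
From mathcomp Require Import reals trigo.
From mathcomp Require Import ring.

Import GRing.Theory.

Local Open Scope ring_scope.

(** Both [A^T] and [\adj A] invert [A] when the determinant is 1, hence they coincide. *)
Lemma cofactor_orthogonal (R : comNzRingType) n (A : 'M[R]_n) (i j : 'I_n) :
  A^T *m A = 1%:M -> \det A = 1 -> A i j = cofactor A i j.
Proof.
move=> AtA detA.
have trA : A^T = \adj A.
  by rewrite -[A^T]mulmx1 -detA -mul_mx_adj mulmxA AtA mul1mx.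
by have /matrixP/(_ j i) := trA; rewrite !mxE.
Qed.

(** The cofactors along row [i] are built from the rows [lift i k'] only, on which [A] and [B]
    agree. *)
Lemma orthogonal_eq_row' (R : comNzRingType) n (A B : 'M[R]_n) (i : 'I_n) :
    A^T *m A = 1%:M -> \det A = 1 -> B^T *m B = 1%:M -> \det B = 1 ->
  (forall k, k != i -> row k A = row k B) -> A = B.
Proof.
move=> AtA detA BtB detB eqAB; apply/matrixP => k j.
have [->|/eqAB/rowP/(_ j)] := eqVneq k i; last by rewrite !mxE.
rewrite !cofactor_orthogonal // /cofactor; congr (_ * \det _).
apply/matrixP => k' j'; rewrite !mxE.
by have /eqAB/rowP/(_ (lift j j')) : lift i k' != i;
  rewrite ?mxE // eq_sym neq_lift.
Qed.

Lemma eq_mulmx_cV (R : pzSemiRingType) m n (A B : 'M[R]_(m, n)) :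
  (forall v : 'cV_n, A *m v = B *m v) -> A = B.
Proof.
move=> eqAB; apply/matrixP => i j.
by have /colP/(_ i) := eqAB (delta_mx j 0); rewrite -!colE !mxE.
Qed.

Lemma SO3_mulmx (R : realType) (A B : 'M[R]_3) :
  is_SO3 A -> is_SO3 B -> is_SO3 (A *m B).
Proof.
move=> [AtA detA] [BtB detB]; split; last by rewrite det_mulmx detA detB mulr1.
by rewrite trmx_mul mulmxA -(mulmxA B^T) AtA mulmx1.
Qed.

Section ExtrRot.
Variables (R : realType) (S : rotation_system).
Implicit Types (v w : 'cV[R]_3) (phi psi : R).

(** Decides every Kronecker delta between distinct axes, whichever way round it appears. *)
Let axesN :
  (ax1 S == ax2 S = false) * (ax1 S == axp S = false) * (ax2 S == axp S = false)
  * (ax2 S == ax1 S = false) * (axp S == ax1 S = false)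
  * (axp S == ax2 S = false).
Proof.
have := axes_uniq S; rewrite /= !inE negb_or andbT => /andP[/andP[]].
move=> /negPf n12 /negPf n1p /negPf n2p.
by rewrite !(eq_sym (ax2 S)) !(eq_sym (axp S)) (eq_sym (ax1 S)) ?n12 ?n1p ?n2p
  eq_sym ?n12 ?n1p ?n2p.
Qed.

(** Three distinct indices exhaust ['I_3] by counting; this allows case analysis along the axes of
    [S] instead of the numerals. *)
Lemma axesP (P : 'I_3 -> Prop) :
  P (ax1 S) -> P (ax2 S) -> P (axp S) -> forall k, P k.
Proof.
move=> P1 P2 Pp k.
have : k \in [:: ax1 S; ax2 S; axp S].
  have sub : {subset [:: ax1 S; ax2 S; axp S] <= enum 'I_3}.
    by move=> i _; rewrite mem_enum.
  have [|_ ->] := uniq_min_size (axes_uniq S) sub; last by rewrite mem_enum.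
  by rewrite size_enum_ord.
by rewrite !inE => /or3P[] /eqP ->.
Qed.

Lemma extr_rot_ax1 phi v :
  (extr_rot S phi *m v) (ax1 S) 0
  = cos phi * v (ax1 S) 0 - sin phi * v (ax2 S) 0.
Proof.
by rewrite extr_rotE /plane_rot /proj /axis !mxE !eqxx !axesN /=; ring.
Qed.

Lemma extr_rot_ax2 phi v :
  (extr_rot S phi *m v) (ax2 S) 0
  = sin phi * v (ax1 S) 0 + cos phi * v (ax2 S) 0.
Proof.
by rewrite extr_rotE /plane_rot /proj /axis !mxE !eqxx !axesN /=; ring.
Qed.

Lemma extr_rot_axp phi v : (extr_rot S phi *m v) (axp S) 0 = v (axp S) 0.
Proof.
by rewrite extr_rotE /plane_rot /proj /axis !mxE !eqxx !axesN /=; ring.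
Qed.

(** In the coordinates of [S] this amounts to the addition formulas for [cos] and [sin]. *)
Lemma extr_rotD phi psi :
  extr_rot S (phi + psi) = extr_rot S phi *m extr_rot S psi.
Proof.
apply: eq_mulmx_cV => v; rewrite -mulmxA; apply/colP; apply: axesP.
- by rewrite !(extr_rot_ax1, extr_rot_ax2) cosD sinD; ring.
- by rewrite !(extr_rot_ax1, extr_rot_ax2) cosD sinD; ring.
- by rewrite !extr_rot_axp.
Qed.

Lemma extr_rot0 : extr_rot S (0 : R) = 1%:M.
Proof.
apply: eq_mulmx_cV => v; rewrite mul1mx; apply/colP; apply: axesP.
- by rewrite extr_rot_ax1 cos0 sin0; ring.
- by rewrite extr_rot_ax2 cos0 sin0; ring.
- exact: extr_rot_axp.
Qed.

Lemma tr_extr_rot phi : (extr_rot S phi)^T = extr_rot S (- phi).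
Proof.
apply/matrixP => i j; move: i j.
by apply: axesP; apply: axesP;
  rewrite /extr_rot /plane_rot /proj /axis !mxE !eqxx !axesN cosN sinN /=; ring.
Qed.

Lemma extr_rot_orthogonal phi : (extr_rot S phi)^T *m extr_rot S phi = 1%:M.
Proof. by rewrite tr_extr_rot -extr_rotD addNr extr_rot0. Qed.

Lemma extr_rot_SO3 phi : is_SO3 (extr_rot S phi).
Proof.
split; first exact: extr_rot_orthogonal.
(* Transposing one of the two half-angle factors turns the square into the determinant of a product
   that is the identity. *)
rewrite [phi]Num.Theory.splitr extr_rotD det_mulmx -[X in X * _]det_tr.
by rewrite -det_mulmx extr_rot_orthogonal det1.
Qed.

(** The perpendicular component of [v] is unchanged, so removing it from the decomposition
    [extr_rotE] leaves the rotated plane part. *)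
Lemma proj_extr_rot phi v :
  proj S (extr_rot S phi *m v) = plane_rot S phi (proj S v).
Proof. by rewrite {1}/proj extr_rot_axp extr_rotE /proj subKr addrK. Qed.

Lemma proj_inj_coord v w k :
  proj S v = proj S w -> k != axp S -> v k 0 = w k 0.
Proof. by move=> /colP/(_ k) + /negPf kp; rewrite !mxE kp !mulr0 !subr0. Qed.

End ExtrRot.

Theorem theorem11p4 (R : realType) (S : rotation_system) (A : 'M[R]_3)
    (phi : R) :
  is_SO3 A ->
  is_rotate_img S A phi (extr_rot S phi *m A) /\
  (forall A' : 'M[R]_3,
     is_rotate_img S A phi A' -> A' = extr_rot S phi *m A).
Proof.
move=> SO_A; have [EAtEA detEA] := SO3_mulmx _ _ _ (extr_rot_SO3 _ S phi) SO_A.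
have colEA j : proj S (col j (extr_rot S phi *m A))
  = plane_rot S phi (proj S (col j A)).
  by rewrite -proj_extr_rot colE -mulmxA -colE.
split=> // A' [[A'tA' detA'] projA'].
(* Off row [axp S], the entries can be read from the projected columns. *)
apply: (orthogonal_eq_row' _ _ _ _ (axp S)) => // k kp; apply/rowP => j.
have : proj S (col j A') = proj S (col j (extr_rot S phi *m A)).
  by rewrite projA' colEA.
by move=> /proj_inj_coord/(_ kp); rewrite [LHS]mxE [RHS]mxE ![row _ _ _ _]mxE.
Qed.
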